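(* Let $D=([n],A)$ be an acyclic digraph. If $\mathcal{W}(D)=\emptyset$, then $\Psi(D,x)=\Omega(\bar D,x)$.
   Context: For distinct vertices $a,b$, write $a\prec_D b$ if $D$ has a directed path from $a$ to $b$, and $a\not\approx_D b$ if neither $a\prec_D b$ nor $b\prec_D a$. $\mathcal{W}(D)$ is the set of $3$-element subsets $\{a,b,c\}\subseteq[n]$ with $a<b<c$ such that $(c,a)\in A$, $a\not\approx_D b$ and $c\not\approx_D b$. $\mathcal{OP}(D)$ is the set of orderings $(u_1,\dots,u_n)$ of $[n]$ such that $(u_i,u_j)\in A$ implies $i<j$. For $a,b\in[n]$, $\delta_D(a,b)=1$ if $a<b$ or $(a,b)\in A$, and $0$ otherwise; for $\pi=(a_1,\dots,a_n)$, $\delta_D(\pi)=\sum_{i=1}^{n-1}\delta_D(a_i,a_{i+1})$. $\Psi(D,x)=\sum_{\pi\in\mathcal{OP}(D)}\binom{x+\delta_D(\pi)}{n}$, where $\binom{x+k}{n}=(x+k)(x+k-1)\cdots(x+k-n+1)/n!$. $\bar D$ is the poset on $[n]$ which is the reflexive transitive closure of $D$, and $\Omega(P,x)$ is the order polynomial of a poset $P$: its value at a positive integer $m$ is the number of order-preserving maps $P\to[m]$ ($u\preceq v\Rightarrow\sigma(u)\le\sigma(v)$). *)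

(* Defs.v *)
From HB Require Import structures.
From mathcomp Require Import all_boot all_order all_algebra perm.

Set Implicit Arguments.
Unset Strict Implicit.
Unset Printing Implicit Defensive.

Import Order.TTheory GRing.Theory Num.Theory.
Local Open Scope ring_scope.

(* A digraph D = ([n], A) is given by its arc relation A on 'I_n, which stands
   for [n] with its usual order, shifted by one.                              *)

(* A nonempty sequence (x_1, .., x_k) satisfies [cycle A] iff
   x_1 -> .. -> x_k -> x_1, so loops are excluded as well. *)
Definition acyclic (n : nat) (A : rel 'I_n) : Prop :=
  forall c : seq 'I_n, c != [::] -> ~~ cycle A c.

Definition dprec (n : nat) (A : rel 'I_n) (a b : 'I_n) : bool :=
  (a != b) && connect A a b.

Definition dincomp (n : nat) (A : rel 'I_n) (a b : 'I_n) : bool :=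
  ~~ dprec A a b && ~~ dprec A b a.

Definition W (n : nat) (A : rel 'I_n) : {set {set 'I_n}} :=
  [set S : {set 'I_n} | [exists a : 'I_n, exists b : 'I_n, exists c : 'I_n,
     [&& S == [set a; b; c], (a < b)%N, (b < c)%N, A c a,
         dincomp A a b & dincomp A c b]]].

(* The ordering (u_1, .., u_n) is the permutation s with s i = u_(i+1). *)
Definition OP (n : nat) (A : rel 'I_n) : {set {perm 'I_n}} :=
  [set s : {perm 'I_n} |
     [forall i : 'I_n, forall j : 'I_n, A (s i) (s j) ==> (i < j)%N]].

Definition delta (n : nat) (A : rel 'I_n) (a b : 'I_n) : nat :=
  (a < b)%N || A a b.

Definition delta_ord (n : nat) (A : rel 'I_n) (s : {perm 'I_n}) : nat :=
  (\sum_(i < n) \sum_(j < n | j == i.+1 :> nat) delta A (s i) (s j))%N.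

Definition binom_poly (k n : nat) : {poly rat} :=
  (n`!%:R)^-1 *: \prod_(i < n) ('X + k%:R%:P - i%:R%:P).

Definition Psi (n : nat) (A : rel 'I_n) : {poly rat} :=
  \sum_(s in OP A) binom_poly (delta_ord A s) n.

Definition order_maps (disp : Order.disp_t) (P : finPOrderType disp)
    (m : nat) : {set {ffun P -> 'I_m}} :=
  [set f : {ffun P -> 'I_m} |
     [forall u : P, forall v : P, (u <= v)%O ==> (f u <= f v)%N]].

Lemma binom_polyE (k n m : nat) :
  (n <= m + k)%N -> (binom_poly k n).[m%:R] = 'C(m + k, n)%:R.
Proof.
move=> le_n; rewrite /binom_poly hornerZ horner_prod.
have -> : \prod_(i < n) ('X + k%:R%:P - i%:R%:P).[m%:R]
          = ((m + k) ^_ n)%:R :> rat.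
  rewrite ffact_prod natr_prod; apply: eq_bigr => i _.
  rewrite !hornerE natrB ?natrD //.
  by apply: leq_trans le_n; apply: ltnW.
by rewrite -bin_ffact natrM mulrC mulfK // pnatr_eq0 -lt0n fact_gt0.
Qed.

Lemma binom_poly0E (n m : nat) : (binom_poly 0 n).[m%:R] = 'C(m, n)%:R.
Proof.
have [le_nm|lt_mn] := leqP n m; first by rewrite binom_polyE addn0.
rewrite bin_small // /binom_poly hornerZ horner_prod.
rewrite (bigD1 (Ordinal lt_mn)) //= [X in _ * (X * _)](_ : _ = 0).
  by rewrite mul0r mulr0.
by rewrite !hornerE subrr.
Qed.

Lemma enum_val_mono (m : nat) (S : {set 'I_m}) :
  {mono (@enum_val _ (mem S)) : i j / (i <= j)%N}.
Proof.
have srt : sorted ltn (map val (enum S)).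
  rewrite /enum_mem sorted_map; apply: sorted_filter; first by move=> y x z; apply: ltn_trans.
  by rewrite -enumT -sorted_map val_enum_ord iota_ltn_sorted.
have lt : {homo (@enum_val _ (mem S)) : i j / (i < j)%N}.
  move=> i j lt_ij; have x0 := enum_val i.
  have lt_size (k : 'I_#|S|) : (k < size (enum S))%N by rewrite -cardE.
  have := @sorted_ltn_nth _ ltn ltn_trans 0%N _ srt i j.
  rewrite !inE size_map !lt_size !(nth_map x0) // -!enum_val_nth.
  exact.
move=> i j; have [le_ij|] := leqP i j; last by move/lt; rewrite ltnNge => /negbTE.
move: le_ij; rewrite leq_eqVlt => /predU1P[/val_inj->|/lt/ltnW//].
by rewrite leqnn.
Qed.

Definition image_maps (disp : Order.disp_t) (P : finPOrderType disp)
    (m : nat) (S : {set 'I_m}) : {set {ffun P -> 'I_m}} :=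
  [set f in order_maps P m | f @: P == S].

Lemma card_image_maps (disp : Order.disp_t) (P : finPOrderType disp)
    (m : nat) (S : {set 'I_m}) :
  #|image_maps P S| = #|image_maps P [set: 'I_#|S|]|.
Proof.
pose h (f : {ffun P -> 'I_#|S|}) := [ffun x => enum_val (f x)] : {ffun P -> 'I_m}.
have h_inj : injective h.
  by move=> f g /ffunP e; apply/ffunP=> x; move: (e x); rewrite !ffunE => /enum_val_inj.
rewrite -(card_imset _ h_inj); congr #|pred_of_set _|; apply/setP=> g.
apply/idP/imsetP.
- rewrite !inE => /andP[/forallP mon /eqP img].
  have inS x : g x \in S by rewrite -img imset_f.
  pose f : {ffun P -> 'I_#|S|} := [ffun x => enum_rank_in (inS x) (g x)].
  have fE x : enum_val (f x) = g x by rewrite ffunE enum_rankK_in.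
  exists f; last by apply/ffunP=> x; rewrite ffunE fE.
  rewrite !inE; apply/andP; split.
    apply/forallP=> u; apply/forallP=> v; apply/implyP=> le_uv.
    rewrite -enum_val_mono !fE.
    by move/forallP: (mon u) => /(_ v); rewrite le_uv.
  apply/eqP/setP=> y; rewrite inE.
  have: enum_val y \in g @: P by rewrite img enum_valP.
  case/imsetP=> x _; rewrite -fE => /enum_val_inj ->; exact: imset_f.
- case=> f; rewrite !inE => /andP[/forallP mon /eqP img] ->.
  apply/andP; split.
    apply/forallP=> u; apply/forallP=> v; apply/implyP=> le_uv.
    rewrite !ffunE enum_val_mono.
    by move/forallP: (mon u) => /(_ v); rewrite le_uv.
  apply/eqP/setP=> y; apply/imsetP/idP.
    by case=> x _ ->; rewrite ffunE enum_valP.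
  move=> yS; have: enum_rank_in yS y \in f @: P by rewrite img inE.
  by case/imsetP=> x _ e; exists x => //; rewrite ffunE -e enum_rankK_in.
Qed.

(* \Omega(P, x) is specified by its values at the positive integers; it is
   unique by order_poly_unique below. *)
Lemma order_poly_sig (disp : Order.disp_t) (P : finPOrderType disp) :
  {p : {poly rat} |
     forall m : nat, (0 < m)%N -> p.[m%:R] = #|order_maps P m|%:R}.
Proof.
exists (\sum_(k < #|P|.+1) #|image_maps P [set: 'I_k]|%:R *: binom_poly 0 k).
move=> m _; rewrite horner_sum.
have -> : #|order_maps P m| =
    (\sum_(S : {set 'I_m}) #|image_maps P [set: 'I_#|S| ]|)%N.
  rewrite -sum1_card (partition_big (fun f : {ffun P -> 'I_m} => f @: P) predT) //=.
  apply: eq_bigr => S _; rewrite -card_image_maps -sum1_card.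
  by apply: eq_bigl => f; rewrite !inE.
have z (S : {set 'I_m}) : (#|P| < #|S|)%N ->
    #|image_maps P [set: 'I_#|S| ]| = 0%N.
  move=> lt; apply/eqP; rewrite cards_eq0 -subset0; apply/subsetP=> f.
  rewrite inE => /andP[_ /eqP e]; move: (leq_imset_card f P).
  by rewrite e cardsT card_ord leqNgt lt.
rewrite (bigID (fun S : {set 'I_m} => (#|S| < #|P|.+1)%N)) /=.
rewrite [X in (_ + X)%N]big1 ?addn0; last by move=> S; rewrite -leqNgt => /z.
rewrite (partition_big (fun S : {set 'I_m} => inord #|S| : 'I_#|P|.+1) predT) //=.
rewrite natr_sum; apply: eq_bigr => k _.
rewrite hornerZ binom_poly0E -natrM; congr _%:R.
rewrite (eq_bigl (fun S : {set 'I_m} => #|S| == k)); last first.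
  move=> S; apply/andP/eqP=> [[lt /eqP <-]|e]; first by rewrite inordK.
  by rewrite e ltn_ord; split=> //; apply/eqP/val_inj; rewrite /= inordK.
rewrite (eq_bigr (fun=> #|image_maps P [set: 'I_k]|)); last by move=> S /eqP ->.
rewrite sum_nat_const mulnC; congr (_ * _)%N.
by rewrite -[m in LHS]card_ord -card_draws; apply: eq_card => S; rewrite inE.
Qed.

Definition order_poly (disp : Order.disp_t) (P : finPOrderType disp) :
  {poly rat} := sval (order_poly_sig P).

Lemma order_polyE (disp : Order.disp_t) (P : finPOrderType disp) (m : nat) :
  (0 < m)%N -> (order_poly P).[m%:R] = #|order_maps P m|%:R.
Proof. exact: (svalP (order_poly_sig P)). Qed.

Lemma poly_eq_posnat (p q : {poly rat}) :
  (forall m : nat, (0 < m)%N -> p.[m%:R] = q.[m%:R]) -> p = q.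
Proof.
move=> pq; apply/eqP; rewrite -subr_eq0; apply/negPn/negP => nz.
pose s := [seq i%:R : rat | i <- iota 1 (size (p - q))].
have: (size s < size (p - q)%R)%N.
  apply: max_poly_roots nz _ _.
    apply/allP=> _ /mapP[i + ->]; rewrite mem_iota => /andP[i0 _].
    by rewrite rootE !hornerE pq // subrr.
  rewrite map_inj_uniq ?iota_uniq // => i j /eqP.
  by rewrite eqr_nat => /eqP.
by rewrite size_map size_iota ltnn.
Qed.

Lemma order_poly_unique (disp : Order.disp_t) (P : finPOrderType disp)
    (p : {poly rat}) :
  (forall m : nat, (0 < m)%N -> p.[m%:R] = #|order_maps P m|%:R) ->
  p = order_poly P.
Proof. by move=> pE; apply: poly_eq_posnat => m m0; rewrite pE ?order_polyE. Qed.

(* The poset \bar D; the acyclicity proof is a phantom parameter from which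
   canonical structure inference gets antisymmetry. *)
Definition dbar (n : nat) (A : rel 'I_n) (hA : acyclic A) : Type := 'I_n.

Section Dbar.
Variables (n : nat) (A : rel 'I_n) (hA : acyclic A).

Lemma connect_acyclic_anti : antisymmetric (connect A).
Proof.
move=> x y /andP[/connectP[p pth ->] /connectP[q pth' e]].
case: p pth pth' e => [//|z p] pth pth' e; exfalso.
have /negP[] : ~~ cycle A (z :: p ++ q) by exact: hA.
move: pth => /= /andP[Axz pth].
by rewrite rcons_path cat_path pth pth' last_cat -e.
Qed.

HB.instance Definition _ := Finite.copy (dbar hA) 'I_n.

HB.instance Definition _ := Order.Le_isPOrder.Build (Order.Disp tt tt)
  (dbar hA) (@connect0 _ A : reflexive (connect A))
  connect_acyclic_anti (@connect_trans _ A).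
Lemma dbar_leE (x y : dbar hA) : (x <= y)%O = connect A x y.
Proof. by []. Qed.
End Dbar.

(* Main.v *)
Require Import Defs.
From HB Require Import structures.
From mathcomp Require Import all_boot all_order all_algebra perm zify.

(* If W(D) is empty, then u < v in the closure of D and v < b < u as labels
   force b to be comparable to u or v: some arc of a path from u to v jumps over
   the label b.  Hence "x precedes y in the closure, or x and y are incomparable
   and x < y" is a strict total order, as any 3-cycle would violate this.
   Sorting [n] first by the values of an order-preserving map f and then by this
   total order attaches to f a unique ordering s in OP(D).  The maps attached to
   a given s are those for which f o s is weakly increasing, strictly so at the
   steps where delta_D = 0; there are binom(m + delta_D(s), n) of them with
   values in [m]. *)

Set Implicit Arguments.
Unset Strict Implicit.
Unset Printing Implicit Defensive.

Import Order.TTheory GRing.Theory Num.Theory.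

Lemma ord_step_trans (n : nat) (r : rel 'I_n) : transitive r ->
  (forall i j : 'I_n, j = i.+1 :> nat -> r i j) ->
  forall i j : 'I_n, i < j -> r i j.
Proof.
move=> r_tr r_step i j lt_ij; have [k] := ubnP (j - i).
elim: k j lt_ij => // k IH j lt_ij le_k.
have lt_j1 : j.-1 < n by apply: leq_ltn_trans (leq_pred j) _.
have j_eq : j = (Ordinal lt_j1).+1 :> nat by rewrite /= (ltn_predK lt_ij).
have := lt_ij; rewrite j_eq ltnS leq_eqVlt => /predU1P[/val_inj->|lt_ij1].
  exact: r_step.
apply: r_tr (r_step _ _ j_eq); apply: IH => //.
by rewrite /= -subn1 subnAC subn1 prednK ?subn_gt0.
Qed.

(** * Sorting along a strict total order *)

Section Sorting.
Variables (n : nat) (r : rel 'I_n).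
Hypotheses (r_irr : irreflexive r) (r_tr : transitive r).
Hypothesis r_total : forall x y, x != y -> r x y || r y x.

Let rank x := #|[set y | r y x]|.

Definition sorts (s : {perm 'I_n}) :=
  [forall i : 'I_n, forall j : 'I_n, (i < j) ==> r (s i) (s j)].

Lemma sortsP (s : {perm 'I_n}) :
  reflect (forall i j : 'I_n, i < j -> r (s i) (s j)) (sorts s).
Proof.
apply: (iffP forallP) => [h i j|h i].
  by move/forallP: (h i) => /(_ j) /implyP.
by apply/forallP=> j; apply/implyP/h.
Qed.

Lemma sorts_ltn (s : {perm 'I_n}) i j : sorts s -> r (s i) (s j) = (i < j).
Proof.
move=> /sortsP srt; case: ltngtP => [/srt->//|lt_ji|/val_inj->]; last exact: r_irr.
by apply/negP=> /(r_tr (srt _ _ lt_ji)); rewrite r_irr.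
Qed.

Lemma rank_lt x : rank x < n.
Proof.
rewrite -[X in _ < X]card_ord -cardsT proper_card // properT.
by apply/eqP=> /setP/(_ x); rewrite !inE r_irr.
Qed.

Lemma rank_mono x y : r x y -> rank x < rank y.
Proof.
move=> rxy; apply/proper_card/properP; split.
  by apply/subsetP=> z; rewrite !inE => /r_tr; apply.
by exists x; rewrite !inE ?r_irr.
Qed.

(** Since [rank] is strictly monotone, totality makes it injective, hence a permutation; its inverse
    lists the elements by rank. *)
Lemma exists_sorts : exists s, sorts s.
Proof.
have rank_inj : injective (fun x => Ordinal (rank_lt x)).
  move=> x y /(congr1 val) /= e; apply/eqP/negPn/negP=> /r_total.
  by case/orP=> /rank_mono; rewrite e ltnn.
exists (perm rank_inj)^-1%g; apply/sortsP=> i j.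
set s := (perm rank_inj)^-1%g => lt_ij.
have rk k : rank (s k) = k.
  by have := congr1 val (permKV (perm rank_inj) k); rewrite permE.
have /r_total/orP[//|/rank_mono] : s i != s j.
  by rewrite (inj_eq perm_inj) -val_eqE /= ltn_eqF.
by rewrite !rk ltnNge ltnW.
Qed.

(** The element at position [i] has exactly [i] predecessors, so [rank] determines a sorting
    permutation. *)
Lemma sorts_uniq s t : sorts s -> sorts t -> s = t.
Proof.
have rk u i : sorts u -> rank (u i) = i.
  move=> srt; rewrite /rank -(card_imset _ (@perm_inj _ u^-1%g)).
  rewrite (_ : _ @: _ = [set j : 'I_n | j < i]); last first.
    apply/setP=> j; rewrite inE -(sorts_ltn _ _ srt); apply/imsetP/idP.
      by case=> y; rewrite inE => ryu ->; rewrite permKV.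
    by move=> ru; exists (u j); rewrite ?inE ?permK.
  rewrite cardsE -sum1_card -(big_ord_widen n (fun=> 1)) ?sum1_card ?card_ord //.
  exact: ltnW.
move=> srt_s srt_t; apply/permP=> i.
rewrite -(permKV t (s i)); congr (t _); apply/val_inj.
by rewrite /= -(rk t) // permKV rk.
Qed.

End Sorting.

(** * Counting sequences with prescribed weak and strict steps *)

(* Adding to [g i] the number of steps [k < i] with [e k = 1] makes every step
   strict. *)
Lemma card_step_maps (n m : nat) (e : 'I_n -> nat) :
  (forall i, e i <= 1) -> (forall i : 'I_n, i.+1 = n -> e i = 0) ->
  #|[set g : {ffun 'I_n -> 'I_m} | [forall i : 'I_n, forall j : 'I_n,
      (j == i.+1 :> nat) ==> (g i < g j + e i)]]| = 'C(m + \sum_i e i, n).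
Proof.
move=> e_le1 e_last; set N := m + _; set G := [set g | _].
pose D (i : nat) := \sum_(k < n | k < i) e k.
have DS (i : 'I_n) : D i.+1 = D i + e i.
  rewrite /D (bigD1 i) //= addnC; congr (_ + _); apply: eq_bigl => k.
  by rewrite ltnS ltn_neqAle andbC.
have DT i : D i <= \sum_k e k.
  by rewrite [leqRHS](bigID (fun k : 'I_n => k < i)) leq_addr.
pose h (g : {ffun 'I_n -> 'I_m}) : n.-tuple 'I_N :=
  [tuple Ordinal (leq_add (ltn_ord (g i)) (DT i)) | i < n].
have hE g i : tnth (h g) i = g i + D i :> nat by rewrite tnth_mktuple.
have h_inj : injective h.
  move=> g1 g2 eg; apply/ffunP=> i; apply/val_inj/(@addIn (D i)).
  by rewrite -!hE eg.
rewrite -card_ltn_sorted_tuples -(card_imset _ h_inj).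
congr #|pred_of_set _|; apply/setP=> t; rewrite inE.
have srtP (u : n.-tuple 'I_N) : reflect
    (forall i j : 'I_n, j = i.+1 :> nat -> tnth u i < tnth u j)
    (sorted ltn (map val u)).
  have nthE (i : 'I_n) : nth 0 (map val u) i = tnth u i.
    by rewrite (nth_map (tnth u i)) ?size_tuple // -tnth_nth.
  apply: (iffP (sortedP 0)) => [srt i j ij|srt i].
    by have := srt i; rewrite size_map size_tuple -ij ltn_ord -!nthE; apply.
  rewrite size_map size_tuple => lt; have := srt (Ordinal (ltnW lt)) (Ordinal lt) erefl.
  by rewrite -!nthE.
apply/imsetP/srtP=> [[g + ->] i j ij|srt].
  rewrite inE => /forallP/(_ i)/forallP/(_ j); rewrite ij eqxx /= => stp.
  by rewrite !hE ij DS; lia.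
have [T TE] : exists T : 'I_n -> nat, forall i, T i = tnth t i.
  by exists (fun i => val (tnth t i)).
have T_lt i : T i < N by rewrite TE.
have {}srt (i j : 'I_n) : j = i.+1 :> nat -> T i < T j by rewrite !TE; apply: srt.
(* [T - D] is weakly increasing, as each step raises [T] by at least 1 and [D] by at most 1; the
   additive form avoids truncated subtraction. *)
have mono (i j : 'I_n) : i <= j -> T i + D j <= T j + D i.
  rewrite leq_eqVlt => /predU1P[/val_inj->//|].
  apply: (ord_step_trans (r := fun i j => T i + D j <= T j + D i)).
    by move=> y x z; lia.
  by move=> k l kl; have := srt k l kl; have := e_le1 k; rewrite kl DS; lia.
(* Comparison with index 0, where [D] is 0, makes the subtraction [T i - D i] exact. *)
have Dle (i : 'I_n) : D i <= T i.
  have := @mono (Ordinal (leq_ltn_trans (leq0n i) (ltn_ord i))) i (leq0n i).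
  by rewrite {2}/D big_pred0 //=; lia.
(* By monotonicity it suffices to bound the last index; [e] vanishes there, so [D] has reached the
   full sum and [T < N] concludes. *)
have lt_m (i : 'I_n) : T i - D i < m.
  have lt_l : n.-1 < n by case: (n) (i) => [[]|].
  have lS : (Ordinal lt_l).+1 = n by rewrite /= (ltn_predK lt_l).
  have Dl : D n.-1 = \sum_k e k.
    transitivity (D n); first by rewrite -lS DS e_last // addn0.
    by apply: eq_bigl => k; rewrite ltn_ord.
  have := @mono i (Ordinal lt_l); rewrite /= Dl => mn.
  have := T_lt (Ordinal lt_l); have := ltn_ord i; have := Dle i.
  by rewrite /N; lia.
exists [ffun i => Ordinal (lt_m i)].
  rewrite inE; apply/forallP=> i; apply/forallP=> j; apply/implyP=> /eqP ij.
  rewrite !ffunE /=; have := srt i j ij; have := Dle i; have := Dle j.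
  by rewrite ij DS; lia.
by apply/eq_from_tnth=> i; apply/val_inj; rewrite /= hE ffunE /= subnK ?TE // -TE.
Qed.

(** For [m + k < n] both sides vanish: the factor of index [m + k] has root [m]. *)
Lemma binom_poly_nat (k n m : nat) :
  ((binom_poly k n).[m%:R] = 'C(m + k, n)%:R)%R.
Proof.
have [le_n|lt_n] := leqP n (m + k); first exact: binom_polyE.
rewrite bin_small // /binom_poly hornerZ horner_prod.
rewrite (bigD1 (Ordinal lt_n)) //= [X in (_ * (X * _))%R](_ : _ = 0%R).
  by rewrite mul0r mulr0.
by rewrite !hornerE natrD subrr.
Qed.

(** * The total order obtained when [W A] is empty *)

Section NoW.
Variables (n : nat) (A : rel 'I_n) (hA : acyclic A) (hW : W A = set0).

Let anti : antisymmetric (connect A) := connect_acyclic_anti hA.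

(** Labels start above [b] and end below it, so the path meets [b] or has an arc from some [x] to
    some [w] with [w < b < x]. As [W A] is empty, [b] is then comparable to [w] or [x], and each
    kind of comparability yields one of the disjuncts. *)
Lemma connect_between (b u v : 'I_n) :
  connect A u v -> v < b -> b < u -> connect A u b || connect A b v.
Proof.
case/connectP=> p; elim: p u => [|w p IH] u /=; first by move=> _ ->; case: ltngtP.
case/andP=> Auw pth v_last lt_vb lt_bu.
have cwv : connect A w v by apply/connectP; exists p.
have cuw := connect1 Auw.
have [lt_bw|lt_wb|/val_inj->] := ltngtP b w; last by rewrite cuw.
  have /orP[cwb|->] := IH w pth v_last lt_vb lt_bw; last by rewrite orbT.
  by rewrite (connect_trans cuw cwb).
have : [set w; b; u] \notin W A by rewrite hW inE.
rewrite inE; apply: contraNT; rewrite negb_or => /andP[nub nbv].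
apply/existsP; exists w; apply/existsP; exists b; apply/existsP; exists u.
have nbw : ~~ connect A b w by apply: contra nbv => /connect_trans; apply.
have nbu : ~~ connect A b u by apply: contra nbw => /connect_trans; apply.
have nwb : ~~ connect A w b by apply: contra nub; apply: connect_trans.
by rewrite eqxx lt_wb lt_bu Auw /dincomp /dprec !negb_and nub nbw nbu nwb !orbT.
Qed.

(* The relation [x] precedes [y] in the closure, or [x] and [y] are incomparable
   and [x < y]. *)
Definition lin (x y : 'I_n) :=
  (x != y) && (connect A x y || ~~ connect A y x && (x < y)).

Lemma lin_irr : irreflexive lin.
Proof. by move=> x; rewrite /lin eqxx. Qed.

Lemma lin_total x y : x != y -> lin x y || lin y x.
Proof.
move=> nxy; rewrite /lin [y == x]eq_sym nxy /=.
by case: (connect A x y) (connect A y x) => [] [] //=; rewrite -neq_ltn.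
Qed.

Lemma connect_lin x y : x != y -> connect A x y -> lin x y.
Proof. by rewrite /lin => -> ->. Qed.

Lemma lin_connectF x y : lin x y -> connect A y x = false.
Proof.
case/andP=> /eqP nxy /orP[cxy|/andP[/negbTE-> //]].
by apply/negP=> cyx; apply/nxy/anti; rewrite cxy.
Qed.

Lemma lin_asym x y : lin x y -> lin y x -> False.
Proof.
move=> lxy lyx; move: (lin_connectF lxy) (lin_connectF lyx).
move: lxy lyx; rewrite /lin => /andP[_ +] /andP[_ +] cyx cxy.
by rewrite cyx cxy /=; case: ltngtP.
Qed.

(** If one step of the cycle were a connection from [a] to [b], the other two could not be, so
    [b < c < a]; then [connect_between] connects [a] to [c] or [c] to [b], against [lin]. Hence all
    three steps are label inequalities, which is absurd. *)
Lemma lin_acyclic3 x y z : lin x y -> lin y z -> lin z x -> False.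
Proof.
have noconn a b c : lin a b -> lin b c -> lin c a -> connect A a b = false.
  move=> lab lbc lca; apply/negP=> cab.
  have [/andP[_ bc] /andP[_ ca]] := conj lbc lca.
  have := lin_connectF lbc; have := lin_connectF lca => nac ncb.
  have nbc : connect A b c = false.
    by apply: contraFF nac => /(connect_trans cab).
  have nca : connect A c a = false.
    by apply: contraFF ncb => /connect_trans; apply.
  move: bc ca; rewrite nbc nca nac ncb /= => lt_bc lt_ca.
  by have := connect_between cab lt_bc lt_ca; rewrite nac ncb.
move=> lxy lyz lzx.
have := noconn _ _ _ lxy lyz lzx; have := noconn _ _ _ lyz lzx lxy.
have := noconn _ _ _ lzx lxy lyz.
case/andP: lxy => _; case/andP: lyz => _; case/andP: lzx => _.
move=> + + + czx cyz cxy; rewrite czx cyz cxy /= => /andP[_ zx] /andP[_ yz] /andP[_ xy].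
by have := ltn_trans (ltn_trans xy yz) zx; rewrite ltnn.
Qed.

Lemma lin_trans : transitive lin.
Proof.
move=> y x z lxy lyz.
have [xz|/lin_total/orP[//|lzx]] := eqVneq x z.
  by case: (lin_asym lxy); rewrite xz.
by case: (lin_acyclic3 lxy lyz lzx).
Qed.

(** * Orderings in [OP A] *)

Lemma OP_ltn s i j : s \in OP A -> A (s i) (s j) -> i < j.
Proof. by rewrite inE => /forallP/(_ i)/forallP/(_ j)/implyP. Qed.

Lemma OP_connect s i j : s \in OP A -> connect A (s i) (s j) -> i <= j.
Proof.
move=> sOP /connectP[p]; elim: p i => [|w p IH] i /=.
  by move=> _ /perm_inj->.
rewrite -(permKV s w) => /andP[/(OP_ltn sOP) lt pth] /IH-/(_ pth).
by move/(leq_trans lt)/ltnW.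
Qed.

(** A path between adjacent positions has no room for an intermediate vertex, so connection means a
    single arc; backward connection is excluded by the ordering. *)
Lemma OP_adjacent s (i j : 'I_n) : s \in OP A -> j = i.+1 :> nat ->
  delta A (s i) (s j) = lin (s i) (s j).
Proof.
move=> sOP ij; congr nat_of_bool.
have nij : s i != s j by rewrite (inj_eq perm_inj) -val_eqE /= ij ltn_eqF.
have nji : connect A (s j) (s i) = false.
  by apply/negP=> /(OP_connect sOP); rewrite ij ltnn.
rewrite /lin nij nji /= orbC; congr (_ || _).
apply/idP/idP=> [|/connectP[[|w p] /=]]; first exact: connect1.
  by move=> _ /eqP; rewrite eq_sym (negbTE nij).
rewrite -(permKV s w) => /andP[Aw pth] lst.
have lt_iw := OP_ltn sOP Aw.
have le_wj : (s^-1)%g w <= j by apply/(OP_connect sOP)/connectP; exists p.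
suff <- : (s^-1)%g w = j by [].
by apply/val_inj/eqP; rewrite eqn_leq le_wj /= ij.
Qed.

(** * Maps attached to an ordering *)

Section Fiber.
Variables (m : nat) (f : {ffun 'I_n -> 'I_m}).

Definition flin (x y : 'I_n) := (f x < f y) || (f x == f y) && lin x y.

Lemma flin_irr : irreflexive flin.
Proof. by move=> x; rewrite /flin ltnn lin_irr andbF. Qed.

Lemma flin_trans : transitive flin.
Proof.
move=> y x z; rewrite /flin => /orP[lt_xy|/andP[/eqP-> lxy]].
  by case/orP=> [/(ltn_trans lt_xy)->//|/andP[/eqP<- _]]; rewrite lt_xy.
by case/orP=> [->//|/andP[-> lyz]]; rewrite (lin_trans lxy lyz) orbT.
Qed.

Lemma flin_total x y : x != y -> flin x y || flin y x.
Proof.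
rewrite /flin -[f x == f y]val_eqE -[f y == f x]val_eqE /=.
by move/lin_total; case: ltngtP; rewrite ?orbT.
Qed.

Definition order_map :=
  [forall u : 'I_n, forall v : 'I_n, connect A u v ==> (f u <= f v)].

Lemma order_mapP :
  reflect (forall u v, connect A u v -> f u <= f v) order_map.
Proof.
apply: (iffP forallP) => [h u v|h u].
  by move/forallP: (h u) => /(_ v) /implyP.
by apply/forallP=> v; apply/implyP/h.
Qed.

Lemma sorts_OP s : order_map -> sorts flin s -> s \in OP A.
Proof.
move=> /order_mapP omf srt; rewrite inE; apply/forallP=> i; apply/forallP=> j.
apply/implyP=> Aij; rewrite -(sorts_ltn flin_irr flin_trans _ _ srt).
have nij : s i != s j.
  by apply/eqP=> eij; have := hA (c := [:: s i]) isT; rewrite /= {2}eij Aij.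
have cij := connect1 Aij; rewrite /flin (connect_lin nij cij) andbT.
by rewrite orbC -leq_eqVlt; apply: omf.
Qed.

(** By [OP_adjacent] the step condition is [flin] at consecutive positions, and transitivity extends
    it to all pairs. Then [f] increases weakly along [s], where connected vertices occur in order,
    so [f] preserves the order. *)
Lemma sorts_steps s : s \in OP A ->
  order_map && sorts flin s = [forall i : 'I_n, forall j : 'I_n,
    (j == i.+1 :> nat) ==> (f (s i) < f (s j) + delta A (s i) (s j))].
Proof.
move=> sOP; apply/andP/forallP=> [[omf /sortsP srt] i|stp].
  apply/forallP=> j; apply/implyP=> /eqP ij; rewrite OP_adjacent //.
  have /srt : i < j by rewrite ij.
  by case/orP=> [/ltn_addr->//|/andP[/eqP-> ->]]; rewrite addn1.
have {}stp (i j : 'I_n) : j = i.+1 :> nat -> f (s i) < f (s j) + lin (s i) (s j).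
  by move=> ij; move/forallP: (stp i) => /(_ j); rewrite ij eqxx OP_adjacent.
have srt : sorts flin s.
  apply/sortsP/ord_step_trans=> [y x z|i j /stp]; first exact: flin_trans.
  rewrite /flin; case: lin; last by rewrite addn0 => ->.
  by rewrite addn1 ltnS andbT leq_eqVlt orbC.
split=> //; apply/order_mapP=> u v; rewrite -(permKV s u) -(permKV s v).
move=> /(OP_connect sOP); rewrite leq_eqVlt => /predU1P[/val_inj->//|].
by move/sortsP: srt => /[apply] /orP[/ltnW//|/andP[/eqP-> _]].
Qed.

End Fiber.

(** * Counting order-preserving maps *)

Lemma card_sorted_maps (m : nat) s : s \in OP A ->
  #|[set f : {ffun 'I_n -> 'I_m} | order_map f && sorts (flin f) s]|
    = 'C(m + delta_ord A s, n).
Proof.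
move=> sOP.
(* This sum has at most one term and is empty at the last position, where [e] is therefore 0. *)
pose e (i : 'I_n) := \sum_(j < n | j == i.+1 :> nat) delta A (s i) (s j).
have eE (i j : 'I_n) : j = i.+1 :> nat -> e i = delta A (s i) (s j).
  by move=> ij; rewrite /e (big_pred1 j) // => k; rewrite /= -ij.
rewrite -(@card_step_maps n m e); first last.
- by move=> i i1; rewrite /e big1 // => j; rewrite i1 ltn_eqF.
- move=> i; rewrite /e; have [lt|ge] := ltnP i.+1 n.
    by rewrite -/(e i) (eE i (Ordinal lt)) // leq_b1.
  by rewrite big1 // => j /eqP ij; have := ltn_ord j; rewrite ij ltnNge ge.
(* Precomposition with [s] turns steps along [s] into steps between consecutive indices. *)
pose h (g : {ffun 'I_n -> 'I_m}) := [ffun i => g (s i)].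
have h_inj : injective h.
  move=> g1 g2 /ffunP eg; apply/ffunP=> x.
  by have := eg (s^-1%g x); rewrite !ffunE permKV.
rewrite -[RHS](card_preimset _ h_inj); apply: eq_card => f.
rewrite !inE sorts_steps //; apply: eq_forallb => i; apply: eq_forallb => j.
by rewrite !ffunE; case: eqP => //= ij; rewrite (eE i j).
Qed.

(** Double counting of pairs of [f] and [s]: exactly one permutation sorts [flin f], and it lies in
    [OP A]. *)
Lemma card_order_map (m : nat) :
  #|[set f : {ffun 'I_n -> 'I_m} | order_map f]|
    = \sum_(s in OP A) 'C(m + delta_ord A s, n).
Proof.
rewrite (eq_bigr _ (fun s sOP => esym (card_sorted_maps m sOP))).
under eq_bigr => s _ do rewrite -sum1dep_card big_mkcondr.
rewrite exchange_big -sum1dep_card; apply: eq_bigr => f omf.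
have [s srt] := exists_sorts (flin_irr f) (@flin_trans _ f) (@flin_total _ f).
rewrite (bigD1 s) ?(sorts_OP omf) //= srt big1 // => t /andP[_ nts].
case: ifP => // /(sorts_uniq (flin_irr f) (@flin_trans _ f) srt) e.
by rewrite e eqxx in nts.
Qed.

End NoW.

Theorem theorem1p3 (n : nat) (A : rel 'I_n) (hA : acyclic A)
  (hW : W A = set0) : Psi A = order_poly (dbar hA).
Proof.
apply: order_poly_unique => m _; rewrite horner_sum.
have -> : #|order_maps (dbar hA) m| = \sum_(s in OP A) 'C(m + delta_ord A s, n).
  (* The order of [dbar hA] is [connect A] by definition, so the two sets of maps agree by
     conversion. *)
  by rewrite -card_order_map.
by rewrite natr_sum; apply: eq_bigr => s _; apply: binom_poly_nat.
Qed.
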